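(* Let $A$ be a commutative associative $\mathbb C$-algebra and $\Delta$ a $2n$-dimensional $\mathbb C$-vector space ($n\ge1$) of commuting $\mathbb C$-derivations of $A$, with basis $\partial_1,\dots,\partial_{2n}$. Let $\mathcal H_n(A,\Delta)=\{D(a)\mid a\in A\}\subset\mathcal W_{2n}(A,\Delta)$, where $$D(a)=\sum_{i=1}^n(\partial_i(a)\partial_{n+i}-\partial_{n+i}(a)\partial_i),$$ and let $H:\mathcal H_n(A,\Delta)\to\mathfrak{sp}_{2n}\otimes A$ be the crossed homomorphism obtained by restricting $$H\Big(\sum_{i=1}^{2n}a_i\partial_i\Big)=\sum_{i=1}^{2n}\sum_{j=1}^{2n}E_{ij}\otimes\partial_i(a_j),\quad a_i\in A.$$ Then there is a functor $\mathcal F_H^A:\mathsf{Rep}_{\mathbb C}(\mathfrak{sp}_{2n})\to\mathsf{ARep}_{\mathbb C}(\mathcal H_n(A,\Delta))$ defined by $$\mathcal F_H^A(V;\theta)=(V\otimes_{\mathbb C}A;(\alpha\boxplus\theta)\circ\iota_H),\quad\forall(V;\theta)\in\mathsf{Rep}_{\mathbb C}(\mathfrak{sp}_{2n}),$$ and by $\psi\mapsto\psi\otimes\mathrm{Id}_A$ on morphisms.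
   Context: $\mathcal W_{2n}(A,\Delta)$ is the space $A\Delta=A\otimes_{\mathbb C}\Delta$ (free over $A$ with basis $\partial_1,\dots,\partial_{2n}$; write $a\partial$ for $a\otimes\partial$), with Lie bracket $[a\partial,b\delta]=a\partial(b)\delta-b\delta(a)\partial$, and $\alpha:A\Delta\to\mathrm{Der}_{\mathbb C}(A)$ is $\alpha(a\partial)(x)=a\partial(x)$. $\mathcal H_n(A,\Delta)$ is a Lie subalgebra, with $[D(a),D(b)]=D\big(\sum_{i=1}^n(\partial_i(a)\partial_{n+i}(b)-\partial_{n+i}(a)\partial_i(b))\big)$, and with the restriction of $\alpha$ (still denoted $\alpha$) it forms a Leibniz pair with $A$. A Leibniz pair $(A,\mathcal S,[\cdot,\cdot],\beta)$ is a Lie algebra $\mathcal S$ with a Lie algebra homomorphism $\beta:\mathcal S\to\mathrm{Der}_{\mathbb C}(A)$. An admissible representation $(M;\rho)$ of it is an $A$-module $M$ with a Lie algebra homomorphism $\rho:\mathcal S\to\mathfrak{gl}_{\mathbb C}(M)$ such that $\rho(x)(am)=a\rho(x)m+\beta(x)(a)m$; morphisms in $\mathsf{ARep}_{\mathbb C}(\mathcal S)$ are $A$-module homomorphisms commuting with the actions of $\mathcal S$. $\mathfrak{sp}_{2n}=\{X\in\mathfrak{gl}_{2n}(\mathbb C): X^TJ+JX=0\}$ with $J=\begin{pmatrix}0&I_n\\-I_n&0\end{pmatrix}$, $\mathsf{Rep}_{\mathbb C}(\mathfrak{sp}_{2n})$ is its category of representations, and $E_{ij}$ are the matrix units. $\mathfrak{sp}_{2n}\otimes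 A$ has bracket $[g\otimes a,h\otimes b]=[g,h]\otimes ab$; $\mathcal S=\mathcal H_n(A,\Delta)$ acts on it by $\alpha(x)(g\otimes a)=g\otimes\alpha(x)(a)$, and a crossed homomorphism is a linear map $H$ with $H[x,y]=\alpha(x)(Hy)-\alpha(y)(Hx)+[Hx,Hy]$. $\iota_H:\mathcal S\to\mathcal S\ltimes_\alpha(\mathfrak{sp}_{2n}\otimes A)$, $\iota_H(x)=(x,Hx)$, where the target is the semidirect product Lie algebra. $V\otimes_{\mathbb C}A$ has $A$-module structure $a(v\otimes b)=v\otimes ab$, and $(\alpha\boxplus\theta)(x,g\otimes a)(v\otimes b)=v\otimes\alpha(x)(b)+\theta(g)v\otimes ab$. *)

(* Defs.v *)
From HB Require Import structures.
From mathcomp Require Import all_boot all_order all_algebra.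
From mathcomp Require Import boolp reals complex.

Set Implicit Arguments.
Unset Strict Implicit.
Unset Printing Implicit Defensive.

Import GRing.Theory.
Local Open Scope ring_scope.
Local Open Scope quotient_scope.

(** [V (x) W] is the set of formal sums of pairs [(v, w)], encoded as lists,
    modulo the congruence generated by commutativity and bilinearity. *)

Section TensorProduct.
Variables (K : fieldType) (V W : lmodType K).

Inductive tens_rel : seq (V * W) -> seq (V * W) -> Prop :=
| tens_refl s : tens_rel s s
| tens_sym s t : tens_rel s t -> tens_rel t s
| tens_trans s t u : tens_rel s t -> tens_rel t u -> tens_rel s u
| tens_cat s s' t t' :
    tens_rel s s' -> tens_rel t t' -> tens_rel (s ++ t) (s' ++ t')
| tens_comm s t : tens_rel (s ++ t) (t ++ s)
| tens_addl v v' w : tens_rel [:: (v + v', w)] [:: (v, w); (v', w)]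
| tens_addr v w w' : tens_rel [:: (v, w + w')] [:: (v, w); (v, w')]
| tens_scale c v w : tens_rel [:: (c *: v, w)] [:: (v, c *: w)]
| tens_zero w : tens_rel [:: (0, w)] [::].

Definition tens_relb : rel (seq (V * W)) := fun s t => `[< tens_rel s t >].

Lemma tens_relb_refl : reflexive tens_relb.
Proof. by move=> s; apply/asboolP; exact: tens_refl. Qed.

Lemma tens_relb_sym : symmetric tens_relb.
Proof.
by move=> s t; apply/idP/idP => /asboolP h; apply/asboolP; exact: tens_sym.
Qed.

Lemma tens_relb_trans : transitive tens_relb.
Proof.
move=> t s u /asboolP h1 /asboolP h2; apply/asboolP; exact: tens_trans h1 h2.
Qed.

Canonical tens_equiv :=
  EquivRel tens_relb tens_relb_refl tens_relb_sym tens_relb_trans.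

Definition tens : Type := {eq_quot tens_equiv}.

HB.instance Definition _ := Choice.on tens.
HB.instance Definition _ := EqQuotient.on tens.

Lemma tens_eqP (s t : seq (V * W)) :
  tens_rel s t <-> \pi_tens s = \pi_tens t.
Proof.
split=> [h|h]; first by apply/eqmodP/asboolP.
by apply/asboolP; move/eqmodP: h.
Qed.

Lemma tens_repr (s : seq (V * W)) : tens_rel (repr (\pi_tens s)) s.
Proof. by apply/tens_eqP; rewrite reprK. Qed.

Definition tens0 : tens := \pi_tens [::].
Definition tens_add (x y : tens) : tens := \pi_tens (repr x ++ repr y).
Definition tens_smul (c : K) (x : tens) : tens :=
  \pi_tens [seq (c *: p.1, p.2) | p <- repr x].
Definition tens_opp (x : tens) : tens := tens_smul (-1) x.

Lemma tens_addE s t :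
  tens_add (\pi_tens s) (\pi_tens t) = \pi_tens (s ++ t).
Proof. by apply/tens_eqP; apply: tens_cat; apply: tens_repr. Qed.

Lemma tens_rel_map c s t : tens_rel s t ->
  tens_rel [seq (c *: p.1, p.2) | p <- s] [seq (c *: p.1, p.2) | p <- t].
Proof.
elim=> {s t} /=.
- by move=> s; exact: tens_refl.
- by move=> s t _; exact: tens_sym.
- by move=> s t u _ h1 _; exact: tens_trans h1.
- by move=> s s' t t' _ h1 _ h2; rewrite !map_cat; exact: tens_cat.
- by move=> s t; rewrite !map_cat; exact: tens_comm.
- by move=> v v' w; rewrite scalerDr; exact: tens_addl.
- by move=> v w w'; exact: tens_addr.
- move=> a v w; rewrite scalerA mulrC -scalerA; exact: tens_scale.
- by move=> w; rewrite scaler0; exact: tens_zero.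
Qed.

Lemma tens_smulE c s :
  tens_smul c (\pi_tens s) = \pi_tens [seq (c *: p.1, p.2) | p <- s].
Proof. by apply/tens_eqP/tens_rel_map/tens_repr. Qed.

Lemma tens_piP (P : tens -> Prop) : (forall s, P (\pi_tens s)) -> forall x, P x.
Proof. by move=> h x; rewrite -(reprK x). Qed.

Lemma tens_addA : associative tens_add.
Proof.
elim/tens_piP=> s; elim/tens_piP=> t; elim/tens_piP=> u.
by rewrite !tens_addE catA.
Qed.

Lemma tens_addC : commutative tens_add.
Proof.
elim/tens_piP=> s; elim/tens_piP=> t.
by rewrite !tens_addE; apply/tens_eqP/tens_comm.
Qed.

Lemma tens_add0 : left_id tens0 tens_add.
Proof. by elim/tens_piP=> s; rewrite tens_addE. Qed.

Lemma tens_smulDr c : {morph tens_smul c : x y / tens_add x y}.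
Proof.
elim/tens_piP=> s; elim/tens_piP=> t.
by rewrite !(tens_addE, tens_smulE) map_cat.
Qed.

Lemma tens_smul0 x : tens_smul 0 x = tens0.
Proof.
elim/tens_piP: x => s; rewrite tens_smulE; apply/tens_eqP.
elim: s => [|[v w] s ih] /=; first exact: tens_refl.
rewrite scale0r; exact: (tens_cat (tens_zero w) ih).
Qed.

Lemma tens_consE p s :
  \pi_tens (p :: s) = tens_add (\pi_tens [:: p]) (\pi_tens s).
Proof. by rewrite tens_addE. Qed.

Lemma tens_smulDl x : {morph tens_smul^~ x : c d / c + d >-> tens_add c d}.
Proof.
move=> c d; elim/tens_piP: x => s; rewrite !tens_smulE.
elim: s => [|[v w] s ih] /=; first by rewrite tens_addE.
rewrite tens_consE ih (tens_consE (c *: v, w)) (tens_consE (d *: v, w)).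
have -> : \pi_tens [:: ((c + d) *: v, w)]
  = tens_add (\pi_tens [:: (c *: v, w)]) (\pi_tens [:: (d *: v, w)]).
  by rewrite tens_addE scalerDl; apply/tens_eqP/tens_addl.
rewrite -!tens_addA; congr tens_add.
by rewrite !tens_addA; congr tens_add; exact: tens_addC.
Qed.

Lemma tens_smul1 : left_id 1 tens_smul.
Proof.
elim/tens_piP=> s; rewrite tens_smulE; congr (\pi_tens _).
by rewrite -[RHS]map_id; apply: eq_map => -[v w] /=; rewrite scale1r.
Qed.

Lemma tens_smulA c d x : tens_smul c (tens_smul d x) = tens_smul (c * d) x.
Proof.
elim/tens_piP: x => s; rewrite !tens_smulE -map_comp; congr (\pi_tens _).
by apply: eq_map => -[v w] /=; rewrite scalerA.
Qed.

Lemma tens_addN : left_inverse tens0 tens_opp tens_add.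
Proof.
move=> x; rewrite /tens_opp -{2}(tens_smul1 x) -tens_smulDl addNr.
exact: tens_smul0.
Qed.

HB.instance Definition _ :=
  GRing.isZmodule.Build tens tens_addA tens_addC tens_add0 tens_addN.
HB.instance Definition _ :=
  GRing.Zmodule_isLmodule.Build K tens
    tens_smulA tens_smul1 tens_smulDr tens_smulDl.

Definition tensor (v : V) (w : W) : tens := \pi_tens [:: (v, w)].

Definition is_bilinear (U : lmodType K) (f : V -> W -> U) : Prop :=
  (forall w, linear (fun v => f v w)) /\ (forall v, linear (f v)).

(** The linear map induced by a bilinear [f]; it is computed on a representative
    and is meaningful, by [tens_liftE] and [tens_lift_linear], only when [f] is
    bilinear. *)
Definition tens_lift (U : lmodType K) (f : V -> W -> U) (t : tens) : U :=
  \sum_(p <- repr t) f p.1 p.2.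

End TensorProduct.

Notation "v '⊗' w" := (tensor v w) (at level 40, left associativity)
  : ring_scope.

Section TensorTheory.
Variables (K : fieldType).
Implicit Types (U V W : lmodType K).

Lemma tens_piD V W (s t : seq (V * W)) :
  \pi_(tens V W) s + \pi_(tens V W) t = \pi_(tens V W) (s ++ t).
Proof. exact: tens_addE. Qed.

Lemma tens_piZ V W c (s : seq (V * W)) :
  c *: \pi_(tens V W) s = \pi_(tens V W) [seq (c *: p.1, p.2) | p <- s].
Proof. exact: tens_smulE. Qed.

Lemma tensor_bilinear V W : is_bilinear (@tensor K V W).
Proof.
split=> [w c v v'|v c w w'].
- rewrite /tensor tens_piZ tens_piD /=.
  by apply/tens_eqP; exact: tens_addl.
- rewrite /tensor tens_piZ tens_piD /=.
  apply/tens_eqP; apply: tens_trans (tens_addr _ _ _) _.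
  exact: (tens_cat (tens_sym (tens_scale _ _ _)) (tens_refl [:: (v, w')])).
Qed.

Lemma tens_sumE V W (s : seq (V * W)) :
  \pi_(tens V W) s = \sum_(p <- s) p.1 ⊗ p.2.
Proof.
elim: s => [|[v w] s ih]; first by rewrite big_nil.
by rewrite big_cons -ih tens_piD.
Qed.

Lemma tens_ind V W (P : tens V W -> Prop) : P 0 ->
  (forall v w t, P t -> P (v ⊗ w + t)) -> forall t, P t.
Proof.
move=> P0 PS; elim/tens_piP=> s; rewrite tens_sumE.
elim: s => [|[v w] s ih]; first by rewrite big_nil.
by rewrite big_cons; exact: PS.
Qed.

Lemma tens_lift_pi V W U (f : V -> W -> U) (s : seq (V * W)) :
  is_bilinear f -> tens_lift f (\pi_(tens V W) s) = \sum_(p <- s) f p.1 p.2.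
Proof.
move=> [fl fr]; rewrite /tens_lift.
have fD v v' w : f (v + v') w = f v w + f v' w.
  by have := fl w 1 v v'; rewrite !scale1r.
have f0 w : f 0 w = 0.
  by apply: (addrI (f 0 w)); rewrite -fD !addr0.
have fZ c v w : f (c *: v) w = c *: f v w.
  by have := fl w c v 0; rewrite f0 !addr0.
have f0r v : f v 0 = 0.
  apply: (addrI (f v 0)); have := fr v 1 0 0.
  by rewrite !scale1r !addr0 => <-.
have := tens_repr s; move: (repr _) => s'; elim=> {s s'} //.
- by move=> s t u _ -> _ ->.
- by move=> s s' t t' _ h1 _ h2; rewrite !big_cat h1 h2.
- by move=> s t; rewrite !big_cat /= addrC.
- by move=> v v' w; rewrite !big_cons !big_nil /= !addr0 fD.
- move=> v w w'; rewrite !big_cons !big_nil /= !addr0.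
  by have := fr v 1 w w'; rewrite !scale1r.
- move=> c v w; rewrite !big_cons !big_nil /= !addr0 fZ.
  by have := fr v c w 0; rewrite f0r !addr0.
- by move=> w; rewrite big_cons !big_nil /= f0 addr0.
Qed.

Lemma tens_liftE V W U (f : V -> W -> U) v w :
  is_bilinear f -> tens_lift f (v ⊗ w) = f v w.
Proof. by move=> bf; rewrite tens_lift_pi // big_cons big_nil addr0. Qed.

Lemma tens_lift_linear V W U (f : V -> W -> U) :
  is_bilinear f -> linear (tens_lift f).
Proof.
move=> bf c; elim/tens_piP=> s; elim/tens_piP=> t.
rewrite tens_piZ tens_piD.
rewrite !tens_lift_pi // big_cat; congr (_ + _).
rewrite big_map scaler_sumr; apply: eq_bigr => -[v w] _ /=.
have h0 : f 0 w = 0.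
  apply: (addrI (f 0 w)); have := bf.1 w 1 0 0.
  by rewrite !scale1r !addr0 => <-.
by have := bf.1 w c v 0; rewrite h0 !addr0.
Qed.

End TensorTheory.

Definition tens_map (K : fieldType) (V V' W W' : lmodType K)
    (f : V -> V') (g : W -> W') : tens V W -> tens V' W' :=
  tens_lift (fun v w => f v ⊗ g w).


Lemma zmod_cancel6 (V : zmodType) (a b c d e f : V) :
  (a - b) - (c - d) + ((c - e) - (f - b)) + ((f - d) - (a - e)) = 0.
Proof.
rewrite !opprB !addrA [LHS](ACl (1*12*7*2*3*10*5*4*11*6*9*8)).
by rewrite /= subrr !(add0r, subrr).
Qed.

Lemma zmod_shuffle3 (V : zmodType)
    (x b y c j x' b' y' c' j' x'' b'' y'' c'' j'' : V) :
  x + b - y + (c + j) + (x' + b' - y' + (c' + j')) +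
  (x'' + b'' - y'' + (c'' + j'')) =
  (x - y) + (x' - y') + (x'' - y'') + ((b + c) + (b' + c') + (b'' + c'')) +
  (j + j' + j'').
Proof.
have h (u v w z k : V) : u + v - w + (z + k) = (u - w) + (v + z) + k.
  by rewrite addrA (addrAC u) (addrA _ v).
have h3 (u v w u' v' w' : V) :
    (u + v + w) + (u' + v' + w') = (u + u') + (v + v') + (w + w').
  by rewrite addrACA (addrACA u).
by rewrite !h (h3 (x - y)) h3.
Qed.

Section LinearFacts.
Variables (K : pzRingType) (U V : lmodType K) (f : U -> V).
Hypothesis lf : linear f.

Lemma linD x y : f (x + y) = f x + f y.
Proof. by have := lf 1 x y; rewrite !scale1r. Qed.

Lemma lin0 : f 0 = 0.
Proof. by apply: (addrI (f 0)); rewrite -linD !addr0. Qed.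

Lemma linZ c x : f (c *: x) = c *: f x.
Proof. by have := lf c x 0; rewrite lin0 !addr0. Qed.

Lemma linN x : f (- x) = - f x.
Proof. by rewrite -scaleN1r linZ scaleN1r. Qed.

Lemma linB x y : f (x - y) = f x - f y.
Proof. by rewrite linD linN. Qed.

Lemma lin_sum I (r : seq I) (P : pred I) (F : I -> U) :
  f (\sum_(i <- r | P i) F i) = \sum_(i <- r | P i) f (F i).
Proof. by apply: big_morph; [exact: linD | exact: lin0]. Qed.

End LinearFacts.

Section TensorMapTheory.
Variables (K : fieldType) (V V' W W' : lmodType K).
Variables (f : V -> V') (g : W -> W').
Hypotheses (lf : linear f) (lg : linear g).

Lemma tens_map_bilinear : is_bilinear (fun v w => f v ⊗ g w).
Proof.
have [bl br] := tensor_bilinear V' W'.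
by split=> [w c v v'|v c w w']; rewrite ?lf ?lg ?bl ?br.
Qed.

Lemma tens_mapE v w : tens_map f g (v ⊗ w) = f v ⊗ g w.
Proof. exact/tens_liftE/tens_map_bilinear. Qed.

Lemma tens_map_linear : linear (tens_map f g).
Proof. exact/tens_lift_linear/tens_map_bilinear. Qed.

End TensorMapTheory.

Lemma tens_ext (K : fieldType) (V W U : lmodType K) (f g : tens V W -> U) :
  linear f -> linear g -> (forall v w, f (v ⊗ w) = g (v ⊗ w)) -> f =1 g.
Proof.
move=> lf lg h; elim/tens_ind=> [|v w t ih]; first by rewrite !lin0.
by rewrite !linD // h ih.
Qed.

HB.mixin Record Lmodule_isLie (K : fieldType) L of GRing.Lmodule K L := {
  lie : L -> L -> L;
  lie_linl : forall y, linear (fun x => lie x y);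
  lie_linr : forall x, linear (lie x);
  liexx : forall x, lie x x = 0;
  lie_jacobi : forall x y z,
    lie x (lie y z) + lie y (lie z x) + lie z (lie x y) = 0
}.

#[short(type="lieAlgType")]
HB.structure Definition LieAlgebra (K : fieldType) :=
  {L of GRing.Lmodule K L & Lmodule_isLie K L}.

Notation "[[ x , y ]]" := (lie x y) (at level 0, x, y at level 99)
  : ring_scope.

Section LieTheory.
Variables (K : fieldType) (L : lieAlgType K).
Implicit Types x y z : L.

Lemma lieDl x x' y : [[x + x', y]] = [[x, y]] + [[x', y]].
Proof. exact: (linD (lie_linl y)). Qed.

Lemma lieDr x y y' : [[x, y + y']] = [[x, y]] + [[x, y']].
Proof. exact: (linD (lie_linr x)). Qed.

Lemma lieC x y : [[x, y]] = - [[y, x]].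
Proof.
apply/eqP; rewrite -addr_eq0; apply/eqP.
by have := liexx (x + y); rewrite lieDl !lieDr !liexx add0r addr0.
Qed.

End LieTheory.

Record lie_action (K : fieldType) (S L : lieAlgType K) := LieAction {
  act_fun :> S -> L -> L;
  act_linl : forall t, linear (fun x => act_fun x t);
  act_linr : forall x, linear (act_fun x);
  act_der : forall x t u,
    act_fun x [[t, u]] = [[act_fun x t, u]] + [[t, act_fun x u]];
  act_lie : forall x y t,
    act_fun [[x, y]] t = act_fun x (act_fun y t) - act_fun y (act_fun x t)
}.

Definition crossed_hom (K : fieldType) (S L : lieAlgType K)
    (act : lie_action S L) (H : S -> L) : Prop :=
  linear H /\
  forall x y, H [[x, y]] = act x (H y) - act y (H x) + [[H x, H y]].

(** The semidirect product of [S] and [L] along [act]; the otherwise unused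
    [act] determines the bracket. *)
Definition semidirect (K : fieldType) (S L : lieAlgType K)
    (act : lie_action S L) : Type := (S * L)%type.

Section Semidirect.
Variables (K : fieldType) (S L : lieAlgType K) (act : lie_action S L).

Local Notation semidirect := (semidirect act).
HB.instance Definition _ := GRing.Lmodule.copy semidirect (S * L)%type.

Definition semidirect_lie (p q : semidirect) : semidirect :=
  ([[p.1, q.1]], act p.1 q.2 - act q.1 p.2 + [[p.2, q.2]]).

Lemma semidirect_linl q : linear (semidirect_lie^~ q).
Proof.
move=> c p p'; congr pair; first exact: lie_linl.
rewrite /= act_linl act_linr lie_linl !scalerDr scalerN opprD.
by rewrite [RHS]addrACA; congr (_ + _); rewrite addrACA.
Qed.

Lemma semidirect_xx p : semidirect_lie p p = 0.
Proof. by congr pair; rewrite /= ?liexx // subrr addr0. Qed.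

Lemma semidirect_linr p : linear (semidirect_lie p).
Proof.
move=> c q q'; congr pair; first exact: lie_linr.
rewrite /= act_linl act_linr lie_linr !scalerDr scalerN opprD.
by rewrite [RHS]addrACA; congr (_ + _); rewrite addrACA.
Qed.

Lemma semidirect_jacobi p q r :
  semidirect_lie p (semidirect_lie q r) +
  semidirect_lie q (semidirect_lie r p) +
  semidirect_lie r (semidirect_lie p q) = 0.
Proof.
case: p q r => [x t] [y u] [z v]; congr pair; rewrite /=.
  exact: lie_jacobi.
have aN w := linN (act_linr act w); have aD w := linD (act_linr act w).
have lN (w : L) := linN (lie_linr w).
rewrite !(aD, aN, lieDr, lN, act_der, act_lie) zmod_shuffle3 lie_jacobi addr0.
rewrite zmod_cancel6. rewrite add0r.
rewrite [ [[act x u, v]] ]lieC [ [[act y v, t]] ]lieC [ [[act z t, u]] ]lieC.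
set a := [[u, act x v]]; set b := [[v, act x u]].
set c := [[t, act z u]]; set d := [[t, act y v]].
set e := [[u, act z t]]; set f := [[v, act y t]].
rewrite (addrC (- b)) (addrC (- d)) (addrC (- e)).
rewrite -(opprB c d) -(opprB a e) -(opprB f b).
by rewrite addrAC zmod_cancel6.
Qed.

HB.instance Definition _ := Lmodule_isLie.Build K semidirect
  semidirect_linl semidirect_linr semidirect_xx semidirect_jacobi.

End Semidirect.

Section Symplectic.
Variables (K : fieldType) (n : nat).
Local Notation gl := 'M[K]_(n + n).

Definition sp_form : gl := block_mx 0 1%:M (- 1%:M) 0.

Definition sp_pred : {pred gl} :=
  fun X => X^T *m sp_form + sp_form *m X == 0.

Lemma sp_submod : submod_closed sp_pred.
Proof.
split=> [|c X Y]; first by rewrite unfold_in trmx0 mul0mx mulmx0 addr0.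
rewrite !unfold_in => /eqP hX /eqP hY.
rewrite linearP /= mulmxDl mulmxDr -scalemxAl -scalemxAr addrACA -scalerDr.
by rewrite hX hY scaler0 addr0.
Qed.

HB.instance Definition _ := GRing.isSubmodClosed.Build K gl sp_pred sp_submod.

Record sp : Type := Sp { sp_mx : gl; _ : sp_mx \in sp_pred }.

HB.instance Definition _ := [isSub for sp_mx].
HB.instance Definition _ := [Choice of sp by <:].
HB.instance Definition _ := [SubChoice_isSubLmodule of sp by <:].

Definition gl_lie (X Y : gl) : gl := X *m Y - Y *m X.

Lemma sp_lie_closed X Y :
  X \in sp_pred -> Y \in sp_pred -> gl_lie X Y \in sp_pred.
Proof.
rewrite !unfold_in => /eqP hX /eqP hY; apply/eqP.
have eX : X^T *m sp_form = - (sp_form *m X) by apply/eqP; rewrite -addr_eq0 hX.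
have eY : Y^T *m sp_form = - (sp_form *m Y) by apply/eqP; rewrite -addr_eq0 hY.
rewrite /gl_lie linearB /= !trmx_mul mulmxBl mulmxBr -!mulmxA eX eY.
by rewrite !mulmxN !mulmxA eX eY !mulNmx !opprK addrA subrK subrr.
Qed.

Definition sp_lie (X Y : sp) : sp := Sp (sp_lie_closed (valP X) (valP Y)).

Lemma sp_linl Y : linear (sp_lie^~ Y).
Proof.
move=> c X X'; apply: val_inj; rewrite /= /gl_lie.
rewrite mulmxDl mulmxDr -scalemxAl -scalemxAr scalerBr opprD.
by rewrite addrACA.
Qed.

Lemma sp_xx X : sp_lie X X = 0.
Proof. by apply: val_inj; rewrite /= /gl_lie subrr. Qed.

Lemma sp_linr X : linear (sp_lie X).
Proof.
move=> c Y Y'; apply: val_inj; rewrite /= /gl_lie.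
rewrite mulmxDl mulmxDr -scalemxAl -scalemxAr scalerBr opprD.
by rewrite addrACA.
Qed.

Lemma sp_jacobi X Y Z :
  sp_lie X (sp_lie Y Z) + sp_lie Y (sp_lie Z X) + sp_lie Z (sp_lie X Y) = 0.
Proof.
apply: val_inj; case: X Y Z => [X hX] [Y hY] [Z hZ] /=.
rewrite /gl_lie !mulmxBl !mulmxBr !mulmxA.
set a := X *m Y *m Z; set b := X *m Z *m Y; set c := Y *m Z *m X.
set d := Z *m Y *m X; set e := Y *m X *m Z; set f := Z *m X *m Y.
exact: zmod_cancel6.
Qed.

HB.instance Definition _ :=
  Lmodule_isLie.Build K sp sp_linl sp_linr sp_xx sp_jacobi.

End Symplectic.

Definition is_derivation (K : fieldType) (A : comAlgType K) (f : A -> A) :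
    Prop :=
  linear f /\ forall a b, f (a * b) = f a * b + a * f b.

(** The three axioms say that [lp_der] is a Lie algebra homomorphism to
    [Der(A)]. *)
Record leibniz_pair (K : fieldType) (A : comAlgType K) := LeibnizPair {
  lp_lie :> lieAlgType K;
  lp_der : lp_lie -> A -> A;
  lp_derivation : forall x, is_derivation (lp_der x);
  lp_linear : forall a, linear (fun x => lp_der x a);
  lp_bracket : forall x y a,
    lp_der [[x, y]] a = lp_der x (lp_der y a) - lp_der y (lp_der x a)
}.

Section TensLiftParam.
Variables (K : fieldType) (V W U : lmodType K).

Lemma tens_lift_comb (f f1 f2 : V -> W -> U) c t :
  (forall v w, f v w = c *: f1 v w + f2 v w) ->
  tens_lift f t = c *: tens_lift f1 t + tens_lift f2 t.
Proof.
move=> h; rewrite /tens_lift scaler_sumr -big_split.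
by apply: eq_bigr => p _; exact: h.
Qed.

End TensLiftParam.

(** The bracket is characterized by [current_lieE] below. *)
Section Current.
Variables (K : fieldType) (g : lieAlgType K) (A : comAlgType K).

Definition current : Type := tens g A.
HB.instance Definition _ := GRing.Lmodule.copy current (tens g A).

Definition current_lie (t u : current) : current :=
  tens_lift (fun x a => tens_lift (fun y b => [[x, y]] ⊗ (a * b)) u) t.

Lemma current_inner_bilin x a :
  is_bilinear (fun y b => [[x : g, y]] ⊗ ((a : A) * b)).
Proof.
have [bl br] := tensor_bilinear g A.
split=> [b c y y'|y c b b']; first by rewrite lie_linr bl.
by rewrite mulrDr -scalerAr br.
Qed.

Lemma current_outer_bilin (u : tens g A) :
  is_bilinear (fun x a => tens_lift (fun y b => [[x : g, y]] ⊗ ((a : A) * b)) u).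
Proof.
have [bl br] := tensor_bilinear g A.
split=> [a c x x'|x c a a']; apply: tens_lift_comb => y b.
  by rewrite lie_linl bl.
by rewrite mulrDl -scalerAl br.
Qed.

Lemma current_linl u : linear (current_lie^~ u).
Proof. exact: (tens_lift_linear (current_outer_bilin u)). Qed.

Lemma current_linr t : linear (current_lie t).
Proof.
move=> c u u'; apply: tens_lift_comb => x a.
exact: (tens_lift_linear (current_inner_bilin x a)).
Qed.

Lemma current_lieE (x y : g) (a b : A) :
  current_lie (x ⊗ a) (y ⊗ b) = [[x, y]] ⊗ (a * b).
Proof.
rewrite /current_lie tens_liftE; last exact: current_outer_bilin.
by rewrite tens_liftE //; exact: current_inner_bilin.
Qed.

Let cDl u := linD (current_linl u).
Let cDr t := linD (current_linr t).
Let c0l u := lin0 (current_linl u).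
Let c0r t := lin0 (current_linr t).

Lemma current_anti t u : current_lie t u + current_lie u t = 0.
Proof.
elim/tens_ind: t => [|x a t iht]; first by rewrite c0l c0r addr0.
rewrite cDl cDr addrACA iht addr0 => {t iht}.
elim/tens_ind: u => [|y b u ihu]; first by rewrite c0l c0r addr0.
rewrite cDl cDr addrACA ihu addr0 !current_lieE mulrC.
have [bl _] := tensor_bilinear g A.
by rewrite -(linD (bl _)) [ [[y, x]] ]lieC subrr (lin0 (bl _)).
Qed.

Lemma current_xx t : current_lie t t = 0.
Proof.
elim/tens_ind: t => [|x a t iht]; first by rewrite c0l.
rewrite cDl !cDr iht addr0 -addrA current_anti addr0 current_lieE liexx.
exact: (lin0 ((tensor_bilinear g A).1 _)).
Qed.

Lemma current_jacobi t u v :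
  current_lie t (current_lie u v) + current_lie u (current_lie v t) +
  current_lie v (current_lie t u) = 0.
Proof.
have add3 (V : zmodType) (a a' b b' c c' : V) :
    a + b + c = 0 -> a' + b' + c' = 0 -> (a + a') + (b + b') + (c + c') = 0.
  by move=> h h'; rewrite (addrACA a) (addrACA (a + b)) h h' addr0.
elim/tens_ind: t => [|x a t iht]; first by rewrite !(c0l, c0r) !addr0.
rewrite !(cDl, cDr); apply: (add3) => // {t iht}.
elim/tens_ind: u => [|y b u ihu]; first by rewrite !(c0l, c0r) !addr0.
rewrite !(cDl, cDr); apply: (add3) => // {u ihu}.
elim/tens_ind: v => [|z d v ihv]; first by rewrite !(c0l, c0r) !addr0.
rewrite !(cDl, cDr); apply: (add3) => // {v ihv}.
rewrite !current_lieE.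
have [bl _] := tensor_bilinear g A.
have -> : b * (d * a) = a * (b * d) by rewrite mulrA mulrC.
have -> : d * (a * b) = a * (b * d) by rewrite mulrC -mulrA.
by rewrite -!(linD (bl _)) lie_jacobi (lin0 (bl _)).
Qed.

HB.instance Definition _ := Lmodule_isLie.Build K current
  current_linl current_linr current_xx current_jacobi.

End Current.

Section CurrentAction.
Variables (K : fieldType) (A : comAlgType K).
Variables (P : leibniz_pair A) (g : lieAlgType K).

Definition current_act (x : P) : current g A -> current g A :=
  tens_map idfun (lp_der x).

Let lid : linear (@idfun g).
Proof. by []. Qed.
Let lder (x : P) : linear (lp_der x).
Proof. by have [] := lp_derivation x. Qed.

Lemma current_actE x (y : g) a : current_act x (y ⊗ a) = y ⊗ lp_der x a.
Proof. exact: tens_mapE. Qed.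

Lemma current_act_linl t : linear (current_act^~ t).
Proof.
have [_ br] := tensor_bilinear g A.
move=> c x x'; apply: tens_lift_comb => y a.
by rewrite lp_linear br.
Qed.

Lemma current_act_linr x : linear (current_act x).
Proof. exact: tens_map_linear. Qed.

Let aD x := linD (current_act_linr x).
Let a0 x := lin0 (current_act_linr x).

Lemma current_act_der x t u :
  current_act x [[t, u]] = [[current_act x t, u]] + [[t, current_act x u]].
Proof.
have l0l (w : current g A) := lin0 (lie_linl w).
have l0r (w : current g A) := lin0 (lie_linr w).
elim/tens_ind: t => [|y a t iht]; first by rewrite !(l0l, a0) add0r.
rewrite !(lieDl, aD) iht [RHS]addrACA; congr (_ + _) => {t iht}.
elim/tens_ind: u => [|z b u ihu]; first by rewrite !(l0r, a0) add0r.
rewrite !(lieDr, aD) ihu [RHS]addrACA; congr (_ + _) => {u ihu}.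
have [_ br] := tensor_bilinear g A.
rewrite [X in current_act x X]current_lieE !current_actE.
rewrite [X in _ = X + _]current_lieE [X in _ = _ + X]current_lieE.
by have [_ ->] := lp_derivation x; rewrite (linD (br _)).
Qed.

Lemma current_act_lie x y t :
  current_act [[x, y]] t =
  current_act x (current_act y t) - current_act y (current_act x t).
Proof.
have [_ br] := tensor_bilinear g A.
elim/tens_ind: t => [|z a t iht]; first by rewrite !a0 subr0.
rewrite !aD iht opprD [RHS]addrACA; congr (_ + _).
by rewrite !current_actE lp_bracket (linB (br _)).
Qed.

Definition current_action : lie_action P (current g A) :=
  LieAction current_act_linl current_act_linr current_act_der current_act_lie.

End CurrentAction.

(** The [K]-vector space underlying an [A]-module. *)
Section Restriction.
Variables (K : fieldType) (A : comAlgType K) (M : lmodType A).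

Definition restr : Type := M.
HB.instance Definition _ := GRing.Zmodule.copy restr M.

Definition restr_scale (c : K) (m : restr) : restr := c%:A *: (m : M).

Lemma restr_scaleA c c' m :
  restr_scale c (restr_scale c' m) = restr_scale (c * c') m.
Proof. by rewrite /restr_scale scalerA -scalerAl mul1r scalerA. Qed.

Lemma restr_scale1 : left_id 1 restr_scale.
Proof. by move=> m; rewrite /restr_scale !scale1r. Qed.

Lemma restr_scaleDr : right_distributive restr_scale +%R.
Proof. by move=> c m m'; exact: scalerDr. Qed.

Lemma restr_scaleDl m : {morph restr_scale^~ m : c c' / c + c'}.
Proof. by move=> c c'; rewrite /restr_scale !scalerDl. Qed.

HB.instance Definition _ := GRing.Zmodule_isLmodule.Build K restr
  restr_scaleA restr_scale1 restr_scaleDr restr_scaleDl.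

End Restriction.

(** A basis of an [m]-dimensional space of commuting derivations of [A]. *)
Record comm_derivations (K : fieldType) (A : comAlgType K) (m : nat) :=
  CommDerivations {
    cd_fun :> 'I_m -> A -> A;
    cd_derivation : forall i, is_derivation (cd_fun i);
    cd_comm : forall i j a, cd_fun i (cd_fun j a) = cd_fun j (cd_fun i a);
    cd_free : forall c : 'I_m -> K,
      (forall a, \sum_i c i *: cd_fun i a = 0) -> forall i, c i = 0
  }.

Section Derivation.
Variables (K : fieldType) (A : comAlgType K) (f : A -> A).
Hypothesis df : is_derivation f.

Lemma derD a b : f (a + b) = f a + f b.
Proof. exact: (linD df.1). Qed.
Lemma derB a b : f (a - b) = f a - f b.
Proof. exact: (linB df.1). Qed.
Lemma derM a b : f (a * b) = f a * b + a * f b.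
Proof. by have [_] := df. Qed.
Lemma der_sum I (r : seq I) (P : pred I) (F : I -> A) :
  f (\sum_(i <- r | P i) F i) = \sum_(i <- r | P i) f (F i).
Proof. exact: (lin_sum df.1). Qed.

End Derivation.

(** [A (x) Delta], free over [A] on the [d i]: the row vector [w] stands for
    the sum of the [w 0 i (x) d i].  The otherwise unused [d] determines the
    bracket. *)
Definition witt (K : fieldType) (A : comAlgType K) (m : nat)
    (d : comm_derivations A m) : Type := restr 'rV[A]_m.

Section Witt.
Variables (K : fieldType) (A : comAlgType K) (m : nat).
Variable d : comm_derivations A m.

Local Notation witt := (witt d).
HB.instance Definition _ := GRing.Lmodule.copy witt (restr 'rV[A]_m).

Definition witt_coef (w : witt) (i : 'I_m) : A := (w : 'rV[A]_m) 0 i.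

Definition witt_der (w : witt) (x : A) : A := \sum_i witt_coef w i * d i x.

Definition witt_lie (u v : witt) : witt :=
  (\row_j (witt_der u (witt_coef v j) - witt_der v (witt_coef u j)) : 'rV[A]_m).

Definition witt_gen (a : A) (i : 'I_m) : witt := (a *: delta_mx 0 i : 'rV[A]_m).

Lemma witt_coefP (u v : witt) : witt_coef u =1 witt_coef v -> u = v.
Proof. by move=> h; apply/rowP=> i; exact: h. Qed.

Lemma witt_coefL i : linear (fun w => witt_coef w i : A).
Proof.
by move=> c u v; rewrite /witt_coef !mxE -scalerAl mul1r.
Qed.

Lemma witt_derivation w : is_derivation (witt_der w).
Proof.
split=> [c a b|a b]; rewrite /witt_der.
  rewrite scaler_sumr -big_split; apply: eq_bigr => i _.
  by have [-> _] := cd_derivation d i; rewrite mulrDr -scalerAr.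
rewrite mulr_suml mulr_sumr -big_split; apply: eq_bigr => i _ /=.
by rewrite (derM (cd_derivation d i)) mulrDr mulrA mulrCA.
Qed.

Lemma witt_der_linear a : linear (fun w => witt_der w a).
Proof.
move=> c u v; rewrite /witt_der scaler_sumr -big_split.
by apply: eq_bigr => i _; rewrite witt_coefL mulrDl -scalerAl.
Qed.

Lemma witt_lie_coef u v i :
  witt_coef (witt_lie u v) i =
  witt_der u (witt_coef v i) - witt_der v (witt_coef u i).
Proof. by rewrite [LHS]mxE. Qed.

Lemma witt_der_lie u v a :
  witt_der (witt_lie u v) a =
  witt_der u (witt_der v a) - witt_der v (witt_der u a).
Proof.
rewrite [witt_der v a]/witt_der [witt_der u a]/witt_der !(der_sum (witt_derivation _)) -sumrB.
have dd : \sum_i witt_coef v i * witt_der u (d i a) =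
          \sum_i witt_coef u i * witt_der v (d i a).
  rewrite /witt_der.
  under eq_bigr do rewrite mulr_sumr.
  rewrite exchange_big; apply: eq_bigr => i _.
  rewrite mulr_sumr; apply: eq_bigr => j _.
  by rewrite (cd_comm d) mulrCA.
under [RHS]eq_bigr do rewrite !(derM (witt_derivation _)) opprD addrACA.
rewrite big_split /= [X in _ + X]sumrB dd subrr addr0; apply: eq_bigr => i _.
by rewrite witt_lie_coef mulrBl.
Qed.

Lemma witt_linl v : linear (witt_lie^~ v).
Proof.
move=> c u u'; apply: witt_coefP => i; rewrite witt_coefL !witt_lie_coef.
rewrite witt_der_linear witt_coefL.
have [-> _] := witt_derivation v.
by rewrite scalerBr opprD addrACA.
Qed.

Lemma witt_linr u : linear (witt_lie u).
Proof.
move=> c v v'; apply: witt_coefP => i; rewrite witt_coefL !witt_lie_coef.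
rewrite witt_der_linear witt_coefL.
have [-> _] := witt_derivation u.
by rewrite scalerBr opprD addrACA.
Qed.

Lemma witt_xx u : witt_lie u u = 0.
Proof.
by apply: witt_coefP => i; rewrite witt_lie_coef subrr (lin0 (witt_coefL i)).
Qed.

Lemma witt_jacobi u v w :
  witt_lie u (witt_lie v w) + witt_lie v (witt_lie w u) +
  witt_lie w (witt_lie u v) = 0.
Proof.
apply: witt_coefP => i; have wD := linD (witt_coefL i).
rewrite (lin0 (witt_coefL i)) !wD !witt_lie_coef !witt_der_lie.
by rewrite !(derB (witt_derivation _)) zmod_cancel6.
Qed.

HB.instance Definition _ := Lmodule_isLie.Build K witt
  witt_linl witt_linr witt_xx witt_jacobi.

Lemma witt_der_gen a i x : witt_der (witt_gen a i) x = a * d i x.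
Proof.
rewrite /witt_der (bigD1 i) //= big1 => [|j ji]; rewrite /witt_coef !mxE /=.
  by rewrite eqxx mulr1 addr0.
by rewrite (negbTE ji) mulr0 mul0r.
Qed.

(** The bracket is determined by
    [[a d_i, b d_j]] = a d_i(b) d_j - b d_j(a) d_i. *)
Lemma witt_lie_gen a b i j :
  [[witt_gen a i, witt_gen b j]] =
  witt_gen (a * d i b) j - witt_gen (b * d j a) i.
Proof.
have der_nat x (k : bool) l : d l (x * k%:R) = d l x * k%:R.
  case: k; rewrite ?mulr1 ?mulr0 //; exact: (lin0 (cd_derivation d l).1).
apply: witt_coefP => k; rewrite (linB (witt_coefL k)) witt_lie_coef.
by rewrite !witt_der_gen /witt_coef !mxE /= !der_nat !mulrA.
Qed.

Definition witt_pair : leibniz_pair A :=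
  @LeibnizPair K A witt witt_der witt_derivation witt_der_linear witt_der_lie.

End Witt.

Section Hamiltonian.
Variables (K : fieldType) (A : comAlgType K) (n : nat).
Variable d : comm_derivations A (n + n).

(** The indices [1, ..., n] and [n + 1, ..., 2n] are the [lshift n i] and the
    [rshift n i]. *)
Definition ham (a : A) : witt d :=
  \sum_(i < n) (witt_gen d (d (lshift n i) a) (rshift n i) -
                witt_gen d (d (rshift n i) a) (lshift n i)).

Definition ham_pred : {pred witt d} := fun w => `[< exists a, w = ham a >].

Lemma ham_coefl a i : witt_coef (ham a) (lshift n i) = - d (rshift n i) a.
Proof.
rewrite (lin_sum (witt_coefL _)) (bigD1 i) //= big1 => [|j ji].
  rewrite (linB (witt_coefL _)) /witt_coef !mxE !eqxx eq_lrshift /= mulr0 mulr1.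
  by rewrite sub0r addr0.
rewrite (linB (witt_coefL _)) /witt_coef !mxE !eqxx eq_lrshift /=.
by rewrite (inj_eq (@lshift_inj n n)) eq_sym (negbTE ji) !mulr0 subrr.
Qed.

Lemma ham_coefr a i : witt_coef (ham a) (rshift n i) = d (lshift n i) a.
Proof.
rewrite (lin_sum (witt_coefL _)) (bigD1 i) //= big1 => [|j ji].
  rewrite (linB (witt_coefL _)) /witt_coef !mxE !eqxx eq_rlshift /= mulr0 mulr1.
  by rewrite subr0 addr0.
rewrite (linB (witt_coefL _)) /witt_coef !mxE !eqxx eq_rlshift /=.
by rewrite (inj_eq (@rshift_inj n n)) eq_sym (negbTE ji) !mulr0 subrr.
Qed.

Lemma ham_ext (w : witt d) a :
  (forall i, witt_coef w (lshift n i) = - d (rshift n i) a) ->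
  (forall i, witt_coef w (rshift n i) = d (lshift n i) a) -> w = ham a.
Proof.
move=> hl hr; apply: witt_coefP => i; case: (split_ordP i) => j ->.
  by rewrite hl ham_coefl.
by rewrite hr ham_coefr.
Qed.

Lemma ham_linear : linear ham.
Proof.
move=> c a b; symmetry; apply: ham_ext => i; rewrite witt_coefL.
  rewrite !ham_coefl; have [-> _] := cd_derivation d (rshift n i).
  by rewrite opprD scalerN.
by rewrite !ham_coefr; have [-> _] := cd_derivation d (lshift n i).
Qed.

Lemma ham_submod : submod_closed ham_pred.
Proof.
split=> [|c u v].
  by apply/asboolP; exists 0; rewrite (lin0 ham_linear).
move=> /asboolP[a ->] /asboolP[b ->]; apply/asboolP; exists (c *: a + b).
by rewrite ham_linear.
Qed.

HB.instance Definition _ := GRing.isSubmodClosed.Build K (witt d) ham_pred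
  ham_submod.

Lemma ham_derE a b : witt_der (ham a) b =
  \sum_(i < n) (d (lshift n i) a * d (rshift n i) b -
                d (rshift n i) a * d (lshift n i) b).
Proof.
rewrite /witt_der big_split_ord /= addrC -big_split /=.
by apply: eq_bigr => i _; rewrite ham_coefl ham_coefr mulNr.
Qed.

Lemma ham_lie a b : [[ham a, ham b]] = ham (
  \sum_(i < n) (d (lshift n i) a * d (rshift n i) b -
                d (rshift n i) a * d (lshift n i) b)).
Proof.
rewrite -ham_derE.
have antisym x y : witt_der (ham x) y = - witt_der (ham y) x.
  rewrite !ham_derE -sumrN; apply: eq_bigr => i _.
  by rewrite opprB mulrC [X in _ - X]mulrC.
have der j : witt_der (ham a) (d j b) - witt_der (ham b) (d j a) =
             d j (witt_der (ham a) b).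
  rewrite [witt_der (ham b) _]antisym opprK !ham_derE.
  rewrite (der_sum (cd_derivation d j)) -big_split; apply: eq_bigr => i _ /=.
  have dd := cd_derivation d j.
  rewrite (derB dd) !(derM dd) !(cd_comm d j) opprD [RHS]addrACA.
  exact: addrC.
apply: ham_ext => i; rewrite witt_lie_coef.
  by rewrite !ham_coefl -der !(linN (witt_derivation _).1) opprB opprK addrC.
by rewrite !ham_coefr der.
Qed.

Record hamiltonian : Type := Hamiltonian {
  ham_val : witt d;
  _ : ham_val \in ham_pred
}.

HB.instance Definition _ := [isSub for ham_val].
HB.instance Definition _ := [Choice of hamiltonian by <:].
HB.instance Definition _ := [SubChoice_isSubLmodule of hamiltonian by <:].

Lemma ham_lie_closed (u v : witt d) :
  u \in ham_pred -> v \in ham_pred -> [[u, v]] \in ham_pred.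
Proof.
by move=> /asboolP[a ->] /asboolP[b ->]; rewrite ham_lie; apply/asboolP; eexists.
Qed.

Definition hamiltonian_lie (x y : hamiltonian) : hamiltonian :=
  Hamiltonian (ham_lie_closed (valP x) (valP y)).

Lemma hamiltonian_linl y : linear (hamiltonian_lie^~ y).
Proof. by move=> c x x'; apply: val_inj; exact: lie_linl. Qed.

Lemma hamiltonian_linr x : linear (hamiltonian_lie x).
Proof. by move=> c y y'; apply: val_inj; exact: lie_linr. Qed.

Lemma hamiltonian_xx x : hamiltonian_lie x x = 0.
Proof. by apply: val_inj; exact: liexx. Qed.

Lemma hamiltonian_jacobi x y z :
  hamiltonian_lie x (hamiltonian_lie y z) +
  hamiltonian_lie y (hamiltonian_lie z x) +
  hamiltonian_lie z (hamiltonian_lie x y) = 0.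
Proof. by apply: val_inj; exact: lie_jacobi. Qed.

HB.instance Definition _ := Lmodule_isLie.Build K hamiltonian
  hamiltonian_linl hamiltonian_linr hamiltonian_xx hamiltonian_jacobi.

Definition hamiltonian_der (x : hamiltonian) : A -> A := witt_der (ham_val x).

Lemma hamiltonian_derivation x : is_derivation (hamiltonian_der x).
Proof. exact: witt_derivation. Qed.

Lemma hamiltonian_der_linear a : linear (fun x => hamiltonian_der x a).
Proof. by move=> c x y; exact: witt_der_linear. Qed.

Lemma hamiltonian_der_lie x y a :
  hamiltonian_der [[x, y]] a =
  hamiltonian_der x (hamiltonian_der y a) -
  hamiltonian_der y (hamiltonian_der x a).
Proof. exact: witt_der_lie. Qed.

Definition hamiltonian_pair : leibniz_pair A :=
  @LeibnizPair K A hamiltonian hamiltonian_der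
    hamiltonian_derivation hamiltonian_der_linear hamiltonian_der_lie.

(** The crossed homomorphism on the ambient [witt d], with values in
    [gl_(2n) (x) A]. *)
Definition jacobian (w : witt d) : tens 'M[K]_(n + n) A :=
  \sum_(i < n + n) \sum_(j < n + n) delta_mx i j ⊗ d i (witt_coef w j).

End Hamiltonian.

(** Unfolds "Lie algebra homomorphism from [L] to [gl(V)]". *)
Record is_lie_rep (K : fieldType) (L : lieAlgType K) (V : lmodType K)
    (rho : L -> V -> V) : Prop := IsLieRep {
  lr_endo : forall x, linear (rho x);
  lr_linear : forall v, linear (fun x => rho x v);
  lr_bracket : forall x y v,
    rho [[x, y]] v = rho x (rho y v) - rho y (rho x v)
}.

Record lie_rep (K : fieldType) (L : lieAlgType K) := LieRep {
  rep_space :> lmodType K;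
  rep_act : L -> rep_space -> rep_space;
  rep_axiom : is_lie_rep rep_act
}.

Definition is_admissible (K : fieldType) (A : comAlgType K)
    (P : leibniz_pair A) (M : lmodType A) (rho : P -> M -> M) : Prop :=
  @is_lie_rep K P (restr M) rho /\
  forall x a m, rho x (a *: m) = a *: rho x m + lp_der x a *: m.

Record adm_rep (K : fieldType) (A : comAlgType K) (P : leibniz_pair A) :=
  AdmRep {
    arep_space :> lmodType A;
    arep_act : P -> arep_space -> arep_space;
    arep_axiom : is_admissible arep_act
  }.

Record category := Category {
  obj :> Type;
  mor : obj -> obj -> Type;
  mid : forall a, mor a a;
  mcomp : forall a b c, mor b c -> mor a b -> mor a c;
  mcomp_idl : forall a b (f : mor a b), mcomp (mid b) f = f;
  mcomp_idr : forall a b (f : mor a b), mcomp f (mid a) = f;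
  mcomp_assoc : forall a b c e (h : mor c e) (g : mor b c) (f : mor a b),
    mcomp h (mcomp g f) = mcomp (mcomp h g) f
}.

Definition is_functor (C D : category) (F0 : C -> D)
    (F1 : forall a b, mor a b -> mor (F0 a) (F0 b)) : Prop :=
  (forall a, F1 a a (mid a) = mid (F0 a)) /\
  (forall a b c (g : mor b c) (f : mor a b),
     F1 a c (mcomp g f) = mcomp (F1 b c g) (F1 a b f)).

Section EquivariantMaps.
Variables (K : pzRingType) (S : Type).

Definition equivariant (V W : lmodType K) (rV : S -> V -> V) (rW : S -> W -> W)
    (f : V -> W) : Prop :=
  linear f /\ forall x v, f (rV x v) = rW x (f v).

Lemma equivariant_id (V : lmodType K) (rV : S -> V -> V) : equivariant rV rV (fun v => v).
Proof. by []. Qed.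

Lemma equivariant_comp (U V W : lmodType K) (rU : S -> U -> U) (rV : S -> V -> V)
    (rW : S -> W -> W) g f :
  equivariant rV rW g -> equivariant rU rV f ->
  equivariant rU rW (fun u => g (f u)).
Proof.
move=> [lg eg] [lf ef]; split=> [c u u'|x u]; first by rewrite lf lg.
by rewrite ef eg.
Qed.

End EquivariantMaps.

Section RepCategory.
Variables (K : fieldType) (L : lieAlgType K).

Definition rep_hom (V W : lie_rep L) : Type :=
  {f : V -> W | equivariant (@rep_act K L V) (@rep_act K L W) f}.

Definition rep_cat : category.
Proof.
refine (@Category (lie_rep L) rep_hom
  (fun V => exist _ _ (equivariant_id (@rep_act K L V)))
  (fun U V W g f => exist _ _ (equivariant_comp (svalP g) (svalP f))) _ _ _).
- by move=> V W [f hf]; exact: eq_exist.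
- by move=> V W [f hf]; exact: eq_exist.
- by move=> T U V W h g f; exact: eq_exist.
Defined.

End RepCategory.

Section AdmRepCategory.
Variables (K : fieldType) (A : comAlgType K) (P : leibniz_pair A).

Definition adm_rep_hom (M N : adm_rep P) : Type :=
  {f : M -> N | equivariant (@arep_act K A P M) (@arep_act K A P N) f}.

Definition adm_rep_cat : category.
Proof.
refine (@Category (adm_rep P) adm_rep_hom
  (fun M => exist _ _ (equivariant_id (@arep_act K A P M)))
  (fun U V W g f => exist _ _ (equivariant_comp (svalP g) (svalP f))) _ _ _).
- by move=> V W [f hf]; exact: eq_exist.
- by move=> V W [f hf]; exact: eq_exist.
- by move=> T U V W h g f; exact: eq_exist.
Defined.

End AdmRepCategory.

(** A copy of [V (x) A], which is a vector space over [K], carrying the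
    [A]-module structure instead. *)
Section ExtendedModule.
Variables (K : fieldType) (V : lmodType K) (A : comAlgType K).

Definition ext_module : Type := tens V A.
HB.instance Definition _ := GRing.Zmodule.copy ext_module (tens V A).

Definition ext_scale (a : A) (t : ext_module) : ext_module :=
  tens_map idfun (fun b => a * b) t.

Let lid : linear (@idfun V).
Proof. by []. Qed.
Let lmul (a : A) : linear (fun b => a * b).
Proof. by move=> c b b'; rewrite mulrDr -scalerAr. Qed.
Let lsc a : linear (tens_map (@idfun V) (fun b : A => a * b)).
Proof. exact: tens_map_linear. Qed.

Lemma ext_scaleE a v b : ext_scale a (v ⊗ b) = v ⊗ (a * b).
Proof. exact: tens_mapE. Qed.

Lemma ext_scaleA a b t : ext_scale a (ext_scale b t) = ext_scale (a * b) t.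
Proof.
elim/tens_ind: t => [|v x t ih]; rewrite /ext_scale ?(lin0 (lsc _)) //.
by rewrite !(linD (lsc _)) [X in _ + X]ih !tens_mapE // mulrA.
Qed.

Lemma ext_scale1 : left_id 1 ext_scale.
Proof.
elim/tens_ind=> [|v x t ih]; rewrite /ext_scale ?(lin0 (lsc _)) //.
by rewrite !(linD (lsc _)) [X in _ + X]ih !tens_mapE // mul1r.
Qed.

Lemma ext_scaleDr : right_distributive ext_scale +%R.
Proof. by move=> a t u; exact: (linD (lsc a)). Qed.

Lemma ext_scaleDl t : {morph ext_scale^~ t : a b / a + b}.
Proof.
move=> a b; rewrite -[ext_scale a t]scale1r.
apply: (tens_lift_comb (c := 1)) => v x.
by rewrite mulrDl scale1r (linD ((tensor_bilinear V A).2 v)).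
Qed.

HB.instance Definition _ := GRing.Zmodule_isLmodule.Build A ext_module
  ext_scaleA ext_scale1 ext_scaleDr ext_scaleDl.

End ExtendedModule.

Section CrossedFunctor.
Variables (K : fieldType) (A : comAlgType K) (P : leibniz_pair A).
Variable (L : lieAlgType K).

Definition crossed_iota (H : P -> current L A) (x : P) :
  semidirect (current_action P L) := (x, H x).

(** [boxplusE] below is the usual description on pure tensors. *)
Definition boxplus (V : lmodType K) (theta : L -> V -> V)
    (p : semidirect (current_action P L)) (t : ext_module V A) :
    ext_module V A :=
  tens_map idfun (lp_der p.1) t +
  tens_lift (fun g a => tens_map (theta g) (fun b => a * b) t) p.2.

Lemma boxplusE (V : lmodType K) (theta : L -> V -> V) x g a v b :
  is_lie_rep theta ->
  boxplus theta (x, g ⊗ a) (v ⊗ b) =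
  v ⊗ lp_der x b + theta g v ⊗ (a * b) :> tens V A.
Proof.
move=> ht; have [bl br] := tensor_bilinear V A.
have lmul c : linear (fun b' : A => c * b').
  by move=> k b1 b2; rewrite mulrDr -scalerAr.
rewrite /boxplus tens_liftE; last first.
  split=> [c k g1 g2|g1 k c c']; apply: tens_lift_comb => w e.
    by rewrite (lr_linear ht) bl.
  by rewrite mulrDl -scalerAl br.
rewrite tens_mapE //; last by have [] := lp_derivation x.
by congr (_ + _); rewrite tens_mapE //; exact: (lr_endo ht).
Qed.

Definition crossed_act (H : P -> current L A) (V : lie_rep L) (x : P) :
    ext_module V A -> ext_module V A :=
  boxplus (@rep_act K L V) (crossed_iota H x).

End CrossedFunctor.

Definition Cplx (R : realType) : fieldType := R[i].

(* Main.v *)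
(** Any representation [theta] of a Lie algebra [L] on [V] extends to an
    [A]-linear action of [L (x) A] on [V (x) A], and the derivations of [A]
    normalize it: [[x, h]] = x(h) as operators.  The crossed homomorphism
    identity for [H] is exactly what makes [x |-> x + H(x)] multiplicative, so
    every crossed homomorphism into [L (x) A] yields a functor.

    The matrix [(d_i(a_j))] of the coefficients of a vector field satisfies the
    crossed homomorphism identity by the Leibniz rule, and for [a = D(f)] the
    symmetry of second derivatives places it in [sp_(2n)(A)].  To obtain an
    element of [sp_(2n) (x) A], a linear projection of [gl_(2n)] onto [sp_(2n)]
    is applied to the matrix units; this does not change a matrix that is
    already symplectic. *)

Require Import Defs.
From mathcomp Require Import all_boot all_order all_algebra.
From mathcomp Require Import boolp reals complex.
Import GRing.Theory.
Local Open Scope ring_scope.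

Set Implicit Arguments.
Unset Strict Implicit.
Unset Printing Implicit Defensive.

(** * Linearity of composites, sums and multiplications *)

Lemma linear_comp_fun (K : pzRingType) (U V W : lmodType K) (g : V -> W)
    (f : U -> V) : linear g -> linear f -> linear (fun u => g (f u)).
Proof. by move=> lg lf c u v; rewrite lf lg. Qed.

Lemma linear_add_fun (K : comPzRingType) (U V : lmodType K) (f g : U -> V) :
  linear f -> linear g -> linear (fun u => f u + g u).
Proof. by move=> lf lg c u v; rewrite lf lg scalerDr addrACA. Qed.

Lemma linear_opp_fun (K : comPzRingType) (U V : lmodType K) (f : U -> V) :
  linear f -> linear (fun u => - f u).
Proof. by move=> lf c u v; rewrite lf scalerN opprD. Qed.

Lemma mull_linear (K : fieldType) (A : comAlgType K) (a : A) :
  linear (fun b => a * b).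
Proof. by move=> c b b'; rewrite mulrDr -scalerAr. Qed.

(** * Operators on V ⊗ A coming from L ⊗ A and from derivations of A *)

Section CurrentModule.
Variables (K : fieldType) (A : comAlgType K) (P : leibniz_pair A).
Variables (L : lieAlgType K) (V : lmodType K) (theta : L -> V -> V).
Hypothesis htheta : is_lie_rep theta.

(** The second summand of [boxplus], isolated so that its interaction with the derivation part can
    be studied separately. *)
Definition current_rep (h : current L A) (t : tens V A) : tens V A :=
  tens_lift (fun g a => tens_map (theta g) (fun b => a * b) t) h.

Lemma current_rep_bilinear t :
  is_bilinear (fun g a => tens_map (theta g) (fun b : A => a * b) t).
Proof.
have [bl br] := tensor_bilinear V A.
split=> [c k g1 g2|g1 k c c']; apply: tens_lift_comb => w e.
  by rewrite (lr_linear htheta) bl.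
by rewrite mulrDl -scalerAl br.
Qed.

Lemma current_rep_linl t : linear (current_rep^~ t).
Proof. exact/tens_lift_linear/current_rep_bilinear. Qed.

Lemma current_rep_linr h : linear (current_rep h).
Proof.
move=> c t u; apply: tens_lift_comb => g a.
exact: (tens_map_linear (lr_endo htheta g) (mull_linear a)).
Qed.

Lemma current_repE g a v b :
  current_rep (g ⊗ a) (v ⊗ b) = theta g v ⊗ (a * b).
Proof.
rewrite /current_rep tens_liftE; last exact: current_rep_bilinear.
by rewrite tens_mapE //; [exact: (lr_endo htheta) | exact: mull_linear].
Qed.

Lemma current_rep_lie h k t :
  current_rep [[h, k]] t =
  current_rep h (current_rep k t) - current_rep k (current_rep h t).
Proof.
have [bl br] := tensor_bilinear V A.
(* Both sides are linear in [h], [k] and [t], so each is replaced in turn by a pure tensor. There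
   commutativity of A gives both products the same A-factor, and the commutator of [theta g] and
   [theta g'] remains. *)
move: h; apply: tens_ext => [||g a].
- exact: linear_comp_fun (current_rep_linl t) (@lie_linl _ _ k).
- apply: linear_add_fun; first exact: current_rep_linl.
  apply: linear_opp_fun.
  exact: linear_comp_fun (current_rep_linr k) (current_rep_linl t).
move: k; apply: tens_ext => [||g' a'].
- exact: linear_comp_fun (current_rep_linl t) (@lie_linr _ _ _).
- apply: linear_add_fun.
    exact: linear_comp_fun (current_rep_linr _) (current_rep_linl t).
  by apply: linear_opp_fun; exact: current_rep_linl.
move: t; apply: tens_ext => [||v b].
- exact: current_rep_linr.
- apply: linear_add_fun.
    exact: linear_comp_fun (current_rep_linr _) (current_rep_linr _).
  apply: linear_opp_fun.
  exact: linear_comp_fun (current_rep_linr _) (current_rep_linr _).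
rewrite [X in current_rep X _]current_lieE !current_repE (lr_bracket htheta).
by rewrite (linB (bl _)) !mulrA [a' * a]mulrC.
Qed.

Lemma tens_map_der_linear (x : P) : linear (tens_map (@idfun V) (lp_der x)).
Proof. by apply: tens_map_linear => //; have [] := lp_derivation x. Qed.

(** The commutation relation between derivations and L ⊗ A; on pure tensors it is the Leibniz rule
    applied to [a * b]. *)
Lemma current_rep_act (x : P) h t :
  tens_map idfun (lp_der x) (current_rep h t) =
  current_rep (current_act x h) t +
  current_rep h (tens_map idfun (lp_der x) t).
Proof.
have [bl br] := tensor_bilinear V A.
have [ld dM] := lp_derivation x.
have mE v b : tens_map (@idfun V) (lp_der x) (v ⊗ b) = v ⊗ lp_der x b.
  by rewrite tens_mapE.
move: h; apply: tens_ext => [||g a].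
- exact: linear_comp_fun (tens_map_der_linear x) (current_rep_linl t).
- apply: linear_add_fun; last exact: current_rep_linl.
  exact: linear_comp_fun (current_rep_linl t) (@current_act_linr _ _ _ _ x).
move: t; apply: tens_ext => [||v b].
- exact: linear_comp_fun (tens_map_der_linear x) (current_rep_linr _).
- apply: linear_add_fun; first exact: current_rep_linr.
  exact: linear_comp_fun (current_rep_linr _) (tens_map_der_linear x).
by rewrite current_actE mE !current_repE mE dM (linD (br _)).
Qed.

(** Makes A-scalings accessible to [tens_ext], which compares K-linear maps only. *)
Lemma ext_scale_linr (a : A) : linear (ext_scale a : tens V A -> tens V A).
Proof. exact: tens_map_linear (mull_linear a). Qed.

Lemma current_rep_ext_scale h a (t : ext_module V A) :
  current_rep h (a *: t) = a *: (current_rep h t : ext_module V A).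
Proof.
move: h; apply: (@tens_ext _ _ _ (tens V A)) => [||g c].
- exact: current_rep_linl.
- exact: linear_comp_fun (ext_scale_linr a) (current_rep_linl t).
move: t; apply: (@tens_ext _ _ _ (tens V A)) => [||v b].
- exact: linear_comp_fun (current_rep_linr _) (ext_scale_linr a).
- exact: linear_comp_fun (ext_scale_linr a) (current_rep_linr _).
rewrite [X in current_rep _ X]ext_scaleE !current_repE.
by rewrite [RHS]ext_scaleE mulrCA.
Qed.

Lemma tens_map_der_ext_scale (x : P) a (t : ext_module V A) :
  tens_map idfun (lp_der x) (a *: t : ext_module V A) =
  a *: (tens_map idfun (lp_der x) t : ext_module V A) + lp_der x a *: t.
Proof.
have [bl br] := tensor_bilinear V A.
have [ld dM] := lp_derivation x.
move: t; apply: (@tens_ext _ _ _ (tens V A)) => [||v b].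
- exact: linear_comp_fun (tens_map_der_linear x) (ext_scale_linr a).
- apply: (@linear_add_fun _ (tens V A) (tens V A)); last exact: ext_scale_linr.
  exact: linear_comp_fun (ext_scale_linr a) (tens_map_der_linear x).
rewrite [X in tens_map _ _ X]ext_scaleE !tens_mapE //.
rewrite [X in _ = X + _]ext_scaleE [X in _ = _ + X]ext_scaleE dM addrC.
exact: (linD (br _)).
Qed.

Lemma tens_map_der_lie (x y : P) (t : tens V A) :
  tens_map idfun (lp_der [[x, y]]) t =
  tens_map idfun (lp_der x) (tens_map idfun (lp_der y) t) -
  tens_map idfun (lp_der y) (tens_map idfun (lp_der x) t).
Proof.
have [_ br] := tensor_bilinear V A.
have ld (z : P) : linear (lp_der z) by have [] := lp_derivation z.
move: t; apply: tens_ext => [||v b].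
- exact: tens_map_der_linear.
- apply: linear_add_fun; last apply: linear_opp_fun;
  exact: linear_comp_fun (tens_map_der_linear _) (tens_map_der_linear _).
by rewrite !tens_mapE // lp_bracket (linB (br _)).
Qed.

(** Two K-structures meet here: [restr] lets [c] act through A on the right factor, whereas [tens]
    scales the left one. They agree because scalars move across ⊗. *)
Lemma restr_ext_scaleE c (t : tens V A) :
  c *: (t : restr (ext_module V A)) = c *: t.
Proof.
have [_ br] := tensor_bilinear V A.
move: t; apply: (@tens_ext _ _ _ (tens V A)) => [||v b].
- exact: (ext_scale_linr c%:A).
- by move=> k t u; rewrite scalerDr !scalerA mulrC.
rewrite [LHS]ext_scaleE -(linZ (br _)).
by rewrite -scalerAl mul1r.
Qed.

End CurrentModule.

(** * Admissible representations and equivariant maps from a crossed homomorphism *)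

Section CrossedRep.
Variables (K : fieldType) (A : comAlgType K) (P : leibniz_pair A).
Variables (L : lieAlgType K) (H : P -> current L A).
Hypothesis crossedH : crossed_hom (current_action P L) H.

Lemma crossed_act_admissible (V : lie_rep L) :
  is_admissible (M := ext_module V A) (crossed_act H (V := V)).
Proof.
have hV := rep_axiom V; have [lH bH] := crossedH.
have lD (x : P) := tens_map_der_linear (V := V) x.
have lR h := current_rep_linr (A := A) hV h.
have actE x t : crossed_act H x t =
    tens_map idfun (lp_der x) t + current_rep (@rep_act K L V) (H x) t by [].
split; last first.
  move=> x a m; rewrite !actE tens_map_der_ext_scale.
  rewrite (current_rep_ext_scale hV) addrAC; congr (_ + _).
  exact/esym/scalerDr.
split=> [x c t u|t c x y|x y t].
- rewrite !actE !restr_ext_scaleE.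
  exact: (linear_add_fun (lD x) (lR (H x))).
- rewrite !actE !restr_ext_scaleE.
  apply: (@linear_add_fun _ P (tens V A) (fun x => tens_map idfun (lp_der x) t)
    (fun x => current_rep (@rep_act K L V) (H x) t)).
    move=> k u v; apply: tens_lift_comb => w b.
    by rewrite lp_linear (tensor_bilinear V A).2.
  exact: linear_comp_fun (current_rep_linl hV t) lH.
rewrite !actE tens_map_der_lie bH !(linD (lD _)) !(linD (lR _)).
rewrite !(linD (current_rep_linl hV _)) (linN (current_rep_linl hV _)).
rewrite (current_rep_lie hV) !(current_rep_act hV) /=.
(* The reordering moves the mixed terms, H(x) after the derivation y and H(y) after the derivation
   x, to the end, each followed by its negative; what precedes them is the left-hand side. *)
rewrite !opprD !addrA [RHS](ACl (1*6*2*7*5*10*4*8*3*9)) /=.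
by rewrite addrK addrK.
Qed.

(** A-scalings and derivations touch only the right factor and [f] only the left, so these commute;
    the equivariance of [f] enters in the [theta] term. *)
Lemma tens_map_equivariant (V W : lie_rep L) (f : V -> W) :
  equivariant (@rep_act K L V) (@rep_act K L W) f ->
  equivariant (V := ext_module V A) (W := ext_module W A)
    (crossed_act H (V := V)) (crossed_act H (V := W)) (tens_map f idfun).
Proof.
move=> [lf ef].
have lm : linear (tens_map f (@idfun A)) by exact: tens_map_linear.
split=> [a t u|x t].
  have sc (z : ext_module V A) :
      tens_map f (@idfun A) (a *: z) = a *: (tens_map f idfun z : ext_module W A).
    move: z; apply: (@tens_ext _ _ _ (tens W A)) => [||v b].
    - exact: linear_comp_fun lm (ext_scale_linr a).
    - exact: linear_comp_fun (ext_scale_linr a) lm.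
    rewrite [X in tens_map _ _ X]ext_scaleE !tens_mapE //.
    by rewrite [RHS]ext_scaleE.
  by rewrite -sc; exact: (linD lm).
have hV := rep_axiom V; have hW := rep_axiom W.
have [ld _] := lp_derivation x.
rewrite /crossed_act /boxplus /=.
rewrite [LHS](linD lm); congr (_ + _).
  move: t; apply: (@tens_ext _ _ _ (tens W A)) => [||v b].
  - exact: linear_comp_fun lm (tens_map_der_linear x).
  - exact: linear_comp_fun (tens_map_der_linear x) lm.
  by rewrite !tens_mapE.
rewrite -/(current_rep (@rep_act K L V) _ _).
rewrite -/(current_rep (@rep_act K L W) _ _).
move: (H x); apply: tens_ext => [||g a].
- exact: linear_comp_fun lm (current_rep_linl hV t).
- exact: current_rep_linl hW _.
move: t; apply: (@tens_ext _ _ _ (tens W A)) => [||v b].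
- exact: linear_comp_fun lm (current_rep_linr hV _).
- exact: linear_comp_fun (current_rep_linr hW _) lm.
by rewrite (current_repE hV) !tens_mapE // (current_repE hW) ef.
Qed.

End CrossedRep.

(** * Functoriality on morphisms *)

Section FunctorData.
Variables (K : fieldType) (A : comAlgType K) (P : leibniz_pair A).
Variables (L : lieAlgType K) (H : P -> current L A).
Variable adm : forall V : rep_cat L,
  is_admissible (M := ext_module V A) (crossed_act H (V := V)).

Definition crossed_functor (V W : rep_cat L) (psi : mor V W) :
    @mor (adm_rep_cat P) (AdmRep (adm V)) (AdmRep (adm W)) :=
  exist _ (tens_map (sval psi) idfun) (tens_map_equivariant H (svalP psi)).

Lemma crossed_functorP :
  is_functor (C := rep_cat L) (D := adm_rep_cat P)
    (F0 := fun V => AdmRep (adm V)) crossed_functor.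
Proof.
have lA : linear (@idfun A) by [].
split=> [V|U V W [g [lg eg] ] [f [lf ef] ] ];
  (* Morphisms are maps paired with a proof, so by proof irrelevance it suffices to compare the
     maps, and these on pure tensors. *)
  apply: eq_exist; apply: funext => t /=.
  move: t; apply: (@tens_ext _ _ _ (tens V A)) => [||v b] //.
    exact: tens_map_linear.
  by rewrite tens_mapE.
move: t; apply: (@tens_ext _ _ _ (tens W A)) => [||v b].
- by apply: tens_map_linear => // c u v; rewrite lf lg.
- exact: linear_comp_fun (tens_map_linear lg lA) (tens_map_linear lf lA).
by rewrite !tens_mapE // => c u u'; rewrite lf lg.
Qed.

End FunctorData.

(** * The projection of matrices onto sp_(2n) *)

Section SymplecticCurrent.
Variables (K : fieldType) (n : nat).
Hypothesis two_neq0 : (2%:R : K) != 0.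
Local Notation J := (sp_form K n).
Local Notation gl := 'M[K]_(n + n).

Lemma sp_formT : J^T = - J.
Proof.
by rewrite /sp_form tr_block_mx !trmx0 linearN /= !trmx1 opp_block_mx !oppr0 opprK.
Qed.

Lemma sp_form_sqr : J *m J = - 1%:M.
Proof.
rewrite /sp_form mulmx_block scalar_mx_block opp_block_mx !oppr0.
by rewrite !(mul0mx, mulmx0, mul1mx, mulmx1, addr0, add0r).
Qed.

(** The projection of [gl_(2n)] onto [sp_(2n)]: as [J^2 = -1], the condition
    [X^T J + J X = 0] amounts to [J X^T J = X]. *)
Definition sp_sym (X : gl) : gl := 2%:R^-1 *: (X + J *m X^T *m J).

(** Up to the factor 1/2, the condition expands to X^T J + J X J J + J X + J J X^T J, and J^2 = -1
    makes the terms cancel in pairs. *)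
Lemma sp_symP X : sp_sym X \in @sp_pred K n.
Proof.
rewrite /sp_sym; apply: rpredZ; rewrite unfold_in; apply/eqP.
have -> : (X + J *m X^T *m J)^T = X^T + J *m X *m J.
  rewrite linearD /= !trmx_mul trmxK sp_formT mulNmx !mulmxN opprK.
  by rewrite mulmxA.
rewrite mulmxDl mulmxDr !mulmxA sp_form_sqr -[J *m X *m J *m J]mulmxA.
rewrite sp_form_sqr !mulNmx mulmxN mulmx1 mul1mx [J *m X - _]addrC addrACA.
by rewrite subrr addNr addr0.
Qed.

Definition sp_proj (X : gl) : sp K n := Sp (sp_symP X).

Lemma sp_proj_linear : linear sp_proj.
Proof.
move=> c X Y; apply: val_inj; rewrite /= /sp_sym.
rewrite linearP /= mulmxDr mulmxDl -scalemxAr -scalemxAl addrACA -scalerDr.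
by rewrite [LHS]scalerDr scalerA mulrC -scalerA.
Qed.

Lemma sp_projK (X : sp K n) : sp_proj (sp_mx X) = X.
Proof.
case: X => X hX; apply: val_inj; rewrite /= /sp_sym.
have := hX; rewrite unfold_in addr_eq0 => /eqP e.
rewrite -mulmxA e mulmxN mulmxA sp_form_sqr mulNmx mul1mx opprK.
by rewrite -mulr2n -scaler_nat scalerA mulVf // scale1r.
Qed.

Lemma sp_proj_deltaE k l i j :
  sp_mx (sp_proj (delta_mx k l)) i j =
  2%:R^-1 * (((i == k) && (j == l))%:R + J i l * J k j).
Proof.
(* Abstracting [J] keeps [mxE] from opening its blocks. *)
rewrite /= /sp_sym trmx_delta; move: J => B.
rewrite !mxE; congr (_ * (_ + _)).
rewrite (bigD1 k) //= big1 ?addr0 => [|m mk]; rewrite !mxE.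
  rewrite (bigD1 l) //= big1 ?addr0 => [|m ml]; rewrite !mxE ?eqxx ?mulr1 //.
  by rewrite (negbTE ml) mulr0.
by rewrite big1 ?mul0r // => p _; rewrite mxE (negbTE mk) andbF mulr0.
Qed.

(** * Elements of sp_(2n) ⊗ A as matrices over A *)

Variable A : comAlgType K.

Definition sp_coef i j (t : current (sp K n) A) : A :=
  tens_lift (fun X a => sp_mx X i j *: (a : A)) t.

Lemma sp_coef_bilinear i j :
  is_bilinear (fun (X : sp K n) (a : A) => sp_mx X i j *: a).
Proof.
split=> [a c X Y|X c a b]; first by rewrite !mxE scalerDl scalerA.
by rewrite scalerDr !scalerA mulrC.
Qed.

Lemma sp_coef_linear i j : linear (sp_coef i j).
Proof. exact/tens_lift_linear/sp_coef_bilinear. Qed.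

Lemma sp_coefE i j (X : sp K n) (a : A) : sp_coef i j (X ⊗ a) = sp_mx X i j *: a.
Proof. exact/tens_liftE/sp_coef_bilinear. Qed.

(** The extension of [sp_proj] to coefficients in A. *)
Definition sp_current (M : 'M[A]_(n + n)) : current (sp K n) A :=
  \sum_i \sum_j sp_proj (delta_mx i j) ⊗ M i j.

Lemma sp_coefK t : sp_current (\matrix_(i, j) sp_coef i j t) = t.
Proof.
have [bl br] := tensor_bilinear (sp K n) A.
move: t; apply: tens_ext => // [c t u|X a]; rewrite /sp_current.
  rewrite scaler_sumr -big_split; apply: eq_bigr => i _ /=.
  rewrite scaler_sumr -big_split; apply: eq_bigr => j _ /=.
  by rewrite !mxE sp_coef_linear br.
(* A matrix unit need not be symplectic, so [X] is first written as its own projection; its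
   expansion in matrix units then stays inside sp_(2n). *)
rewrite -{2}(sp_projK X) [in RHS](matrix_sum_delta (sp_mx X)).
rewrite (lin_sum sp_proj_linear) (lin_sum (bl a)); apply: eq_bigr => i _.
rewrite (lin_sum sp_proj_linear) (lin_sum (bl a)); apply: eq_bigr => j _.
by rewrite mxE sp_coefE (linZ sp_proj_linear) (linZ (br _)) (linZ (bl _)).
Qed.

(** Reduces identities in sp_(2n) ⊗ A to identities between entries in A, without choosing a basis
    of sp_(2n). *)
Lemma sp_coef_inj t u : (forall i j, sp_coef i j t = sp_coef i j u) -> t = u.
Proof.
move=> h; rewrite -(sp_coefK t) -(sp_coefK u); congr sp_current.
by apply/matrixP=> i j; rewrite !mxE.
Qed.

(** The composite opposite to [sp_coefK] is not the identity but the averaging [sp_sym], carried out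
    over A. *)
Lemma sp_coef_current (M : 'M[A]_(n + n)) i j :
  sp_coef i j (sp_current M) =
  2%:R^-1 *: (M i j + (map_mx (in_alg A) J *m M^T *m map_mx (in_alg A) J) i j).
Proof.
have -> : M i j = \sum_k \sum_l ((i == k) && (j == l))%:R *: M k l.
  rewrite (bigD1 i) //= [X in _ = _ + X]big1 ?addr0 => [|k ki].
    rewrite (bigD1 j) //= big1 ?addr0 => [|l lj]; first by rewrite !eqxx scale1r.
    by rewrite eq_sym (negbTE lj) andbF scale0r.
  by rewrite big1 // => l _; rewrite eq_sym (negbTE ki) scale0r.
rewrite mxE -big_split scaler_sumr (lin_sum (sp_coef_linear i j)).
apply: eq_bigr => k _ /=.
rewrite !mxE mulr_suml -big_split scaler_sumr (lin_sum (sp_coef_linear i j)).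
apply: eq_bigr => l _ /=.
rewrite sp_coefE sp_proj_deltaE -scalerA scalerDl !mxE; congr (_ *: (_ + _)).
by rewrite -!scalerAl mul1r -scalerAr mulr1 scalerA.
Qed.

(** In entries, the bracket becomes the commutator of matrices over A. *)
Lemma sp_coef_lie i j t u :
  sp_coef i j [[t, u]] =
  \sum_k (sp_coef i k t * sp_coef k j u - sp_coef i k u * sp_coef k j t).
Proof.
have lc := sp_coef_linear.
move: t; apply: tens_ext => [||X a].
- exact: linear_comp_fun (lc i j) (@lie_linl _ _ u).
- move=> c t t'; rewrite scaler_sumr -big_split; apply: eq_bigr => k _ /=.
  rewrite !lc mulrDl mulrDr -scalerAl -scalerAr scalerBr opprD.
  by rewrite addrACA.
move: u; apply: tens_ext => [||Y b].
- exact: linear_comp_fun (lc i j) (@lie_linr _ _ _).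
- move=> c t t'; rewrite scaler_sumr -big_split; apply: eq_bigr => k _ /=.
  rewrite !lc mulrDl mulrDr -scalerAl -scalerAr scalerBr opprD.
  by rewrite addrACA.
rewrite [X in sp_coef _ _ X]current_lieE !sp_coefE /= /gl_lie !mxE -sumrB.
rewrite scaler_suml.
apply: eq_bigr => k _; rewrite !sp_coefE scalerBl.
by rewrite -!scalerAl -!scalerAr !scalerA [b * a]mulrC.
Qed.

Lemma sp_coef_act (P : leibniz_pair A) (x : P) i j t :
  sp_coef i j (current_act x t) = lp_der x (sp_coef i j t).
Proof.
have [ld _] := lp_derivation x.
move: t; apply: tens_ext => [||X a].
- exact: linear_comp_fun (sp_coef_linear i j) (@current_act_linr _ _ _ _ x).
- exact: linear_comp_fun ld (sp_coef_linear i j).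
by rewrite current_actE !sp_coefE (linZ ld).
Qed.

Lemma sp_mx_currentE t :
  tens_map (@sp_mx K n) idfun t =
  \sum_i \sum_j delta_mx i j ⊗ sp_coef i j t.
Proof.
have [bl br] := tensor_bilinear gl A.
move: t; apply: tens_ext => [||X a].
- exact: tens_map_linear.
- move=> c t u; rewrite scaler_sumr -big_split; apply: eq_bigr => i _ /=.
  rewrite scaler_sumr -big_split; apply: eq_bigr => j _ /=.
  by rewrite sp_coef_linear br.
rewrite tens_mapE // [in LHS](matrix_sum_delta (sp_mx X)).
rewrite (lin_sum (bl a)); apply: eq_bigr => i _.
rewrite (lin_sum (bl a)); apply: eq_bigr => j _.
by rewrite sp_coefE (linZ (br _)) (linZ (bl _)).
Qed.

(** * The Jacobian of a Hamiltonian vector field *)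

Variable d : comm_derivations A (n + n).

Definition jacobian_mx (w : witt d) : 'M[A]_(n + n) :=
  \matrix_(i, j) d i (witt_coef w j).

(** The blocks of this Jacobian are, up to sign, blocks of the Hessian of [a]. As the derivations
    commute, the off-diagonal blocks are symmetric and the diagonal ones are negative transposes of
    each other, which is the symplectic condition over A. *)
Lemma jacobian_mx_ham a :
  map_mx (in_alg A) J *m (jacobian_mx (ham d a))^T *m map_mx (in_alg A) J =
  jacobian_mx (ham d a).
Proof.
have dN i b : d i (- b) = - d i b by exact: (linN (cd_derivation d i).1).
have -> : map_mx (in_alg A) J = block_mx 0 1%:M (- 1%:M) 0.
  by rewrite map_block_mx !map_mxN !map_mx0 !map_mx1.
rewrite -[jacobian_mx _]submxK; set N := jacobian_mx _.
have ul : (ulsubmx N)^T = - drsubmx N.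
  by apply/matrixP=> i j; rewrite !mxE ham_coefl ham_coefr dN (cd_comm d).
have ur : (ursubmx N)^T = ursubmx N.
  by apply/matrixP=> i j; rewrite !mxE !ham_coefr (cd_comm d).
have dl : (dlsubmx N)^T = dlsubmx N.
  by apply/matrixP=> i j; rewrite !mxE !ham_coefl !dN (cd_comm d).
have dr : (drsubmx N)^T = - ulsubmx N.
  by rewrite -[ulsubmx N]trmxK ul linearN opprK.
rewrite tr_block_mx ul ur dl dr !mulmx_block.
rewrite !(mul0mx, mulmx0, mul1mx, mulmx1, mulNmx, mulmxN).
by rewrite !(addr0, add0r, opprK).
Qed.

Definition ham_crossed (x : hamiltonian_pair d) : current (sp K n) A :=
  sp_current (jacobian_mx (ham_val x)).

(** The projection has no effect here: it averages the Jacobian with a matrix equal to it by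
    [jacobian_mx_ham]. *)
Lemma sp_coef_ham_crossed (x : hamiltonian d) i j :
  sp_coef i j (ham_crossed x) = d i (witt_coef (ham_val x) j).
Proof.
rewrite sp_coef_current; have /asboolP[a ->] := valP x.
rewrite jacobian_mx_ham mxE -mulr2n -scaler_nat scalerA mulVf //.
by rewrite scale1r.
Qed.

Lemma ham_crossedE (x : hamiltonian d) :
  tens_map (@sp_mx K n) idfun (ham_crossed x) = jacobian (ham_val x).
Proof.
rewrite sp_mx_currentE; apply: eq_bigr => i _; apply: eq_bigr => j _.
by rewrite sp_coef_ham_crossed.
Qed.

Lemma ham_crossed_hom :
  crossed_hom (current_action (hamiltonian_pair d) (sp K n)) ham_crossed.
Proof.
have lc := sp_coef_linear.
split=> [c x y|x y]; apply: sp_coef_inj => i j.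
  by rewrite lc !sp_coef_ham_crossed witt_coefL (cd_derivation d i).1.
rewrite (linD (lc i j)) (linB (lc i j)) sp_coef_lie !sp_coef_act.
rewrite !sp_coef_ham_crossed [witt_coef _ _]witt_lie_coef.
rewrite (derB (cd_derivation d i)) /witt_der !(der_sum (cd_derivation d i)).
rewrite -!sumrB -big_split; apply: eq_bigr => k _ /=.
(* For coefficients u, v of x, y, the Leibniz rule splits d_i(u_k d_k v_j) into d_i(u_k) d_k(v_j), a
   term of the matrix product, and u_k d_k(d_i v_j), a term of x acting on the entries of H(y). *)
rewrite !sp_coef_ham_crossed !(derM (cd_derivation d i)) !(cd_comm d i k).
by rewrite opprD addrACA addrC.
Qed.

End SymplecticCurrent.

Theorem corollary4p18 (R : realType) (A : comAlgType (Cplx R)) (n : nat)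
    (hn : (1 <= n)%N) (d : comm_derivations A (n + n)) :
  exists H : hamiltonian_pair d -> current (sp (Cplx R) n) A,
    (forall x : hamiltonian d,
       tens_map (@sp_mx (Cplx R) n) idfun (H x) = jacobian (ham_val x)) /\
    crossed_hom (current_action (hamiltonian_pair d) (sp (Cplx R) n)) H /\
    exists (adm : forall V : rep_cat (sp (Cplx R) n),
              is_admissible (P := hamiltonian_pair d) (M := ext_module V A)
                (crossed_act H (V := V)))
           (F : forall V W : rep_cat (sp (Cplx R) n), mor V W ->
              @mor (adm_rep_cat (hamiltonian_pair d))
                (AdmRep (adm V)) (AdmRep (adm W))),
      (forall V W (psi : mor V W),
         sval (F V W psi) = tens_map (sval psi) idfun) /\
      @is_functor (rep_cat (sp (Cplx R) n)) (adm_rep_cat (hamiltonian_pair d))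
        (fun V => AdmRep (adm V)) F.
Proof.
(* The halving in [sp_sym] needs this; it comes from the numeric structure of [R[i]]. *)
have two_neq0 : (2%:R : Cplx R) != 0 by rewrite (Num.Theory.pnatr_eq0 R[i]).
exists (@ham_crossed _ _ A d); split; first exact: ham_crossedE.
have crossedH := ham_crossed_hom two_neq0 d; split=> //.
exists (crossed_act_admissible crossedH).
exists (@crossed_functor _ _ _ _ _ (crossed_act_admissible crossedH)).
by split=> //; exact: crossed_functorP.
Qed.
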